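(* If $(\hat t_k,\hat{\bm\mu}_k,\hat{\bm b}_k)$, $k=1,\dots,K$, solves problem (P2) defined in the context, then $$\hat t_k=\begin{cases}\beta_k/\hat R_k, & \text{if } k\neq k^*,\\[2pt] 1-\sum_{j\neq k^*}\beta_j/\hat R_j, & \text{if } k=k^*,\end{cases}$$ where $$\hat R_k=\log_2\Big(1+\frac{\rho}{\sigma^2}\big|(\bm A_k\hat{\bm\mu}_k+\bm c_k)^{\rm H}\hat{\bm b}_k\big|^2\Big)$$ and $k^*=\arg\max_{k}\,|(\bm A_k\hat{\bm\mu}_k+\bm c_k)^{\rm H}\hat{\bm b}_k|$.
   Context: Let $K,N,M\ge 1$ be integers, $\rho>0$ (transmission power) and $\sigma^2>0$ (noise variance) real numbers, and $\beta_1,\dots,\beta_K$ real numbers ($\beta_k$ is the individual rate requirement of the $k$th user). Let $\bm r\in\mathbb C^{N}$ with $\|\bm r\|_2=1$, $\bm F\in\mathbb C^{M\times N}$, and for each $k\in\{1,\dots,K\}$ let $\bm h_k\in\mathbb C^N$ and $\bm g_k\in\mathbb C^M$ be given. Put $\bm R=\mathrm{diag}(\bm r)$, $\bm G_k=\mathrm{diag}(\bm g_k)$, $\bm c_k=\bm R^{\rm H}\bm h_k\in\mathbb C^N$ and $\bm A_k=\bm R^{\rm H}\bm F^{\rm H}\bm G_k\in\mathbb C^{N\times M}$, where $^{\rm H}$ denotes conjugate transpose. Problem (P2): over all $t_k\in\mathbb R$, $\bm\mu_k=(\mu_{1,k},\dots,\mu_{M,k})^{\rm T}\in\mathbb C^M$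 and $\bm b_k=(b_{1,k},\dots,b_{N,k})^{\rm T}\in\mathbb C^N$, $k=1,\dots,K$, maximize $$\sum_{k=1}^K t_k\log_2\Big(1+\frac{\rho}{\sigma^2}\big|(\bm A_k\bm\mu_k+\bm c_k)^{\rm H}\bm b_k\big|^2\Big)$$ subject to: $t_k\log_2\big(1+\frac{\rho}{\sigma^2}|(\bm A_k\bm\mu_k+\bm c_k)^{\rm H}\bm b_k|^2\big)\ge\beta_k$ for all $k$; $|\mu_{i,k}|=1$ and $|b_{i,k}|=1$ for all $i,k$; $\sum_{k=1}^K t_k=1$; and $t_k\ge 0$ for all $k$.
   Formalization: The maximiser k* is assumed unique (with ties k* is undefined and the formula can fail), and β_k ≥ 0 is assumed for all k ≠ k* (if β_k < 0 the formula would give a negative time or divide by zero). *)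

(* Defs.v *)
From HB Require Import structures.
From mathcomp Require Import all_boot all_order all_algebra.
From mathcomp Require Import complex.
From mathcomp Require Import reals exp.

Set Implicit Arguments.
Unset Strict Implicit.
Unset Printing Implicit Defensive.

Import Order.TTheory GRing.Theory Num.Theory.
Import ComplexField.Normc.
Local Open Scope ring_scope.
Local Open Scope complex_scope.
Local Open Scope sesquilinear_scope.

(* Complex numbers are [R[i]] with [R : realType].  [normc] is the modulus with
   values in [R], and [M ^t*] is the conjugate transpose. *)

Definition log2 (R : realType) (x : R) : R := ln x / ln 2.

Definition norm2 (R : realType) (n : nat) (v : 'cV[R[i]]_n) : R :=
  Num.sqrt (\sum_(i < n) normc (v i 0) ^+ 2).

Definition unimodular (R : realType) (n : nat) (v : 'cV[R[i]]_n) : Prop :=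
  forall i : 'I_n, normc (v i 0) = 1.

Definition diagc (R : realType) (n : nat) (v : 'cV[R[i]]_n) : 'M[R[i]]_n :=
  diag_mx v^T.

(* c = R^H h with R = diag(r) *)
Definition direct_channel (R : realType) (N : nat)
    (r h : 'cV[R[i]]_N) : 'cV[R[i]]_N :=
  (diagc r)^t* *m h.

(* A = R^H F^H G with R = diag(r) and G = diag(g) *)
Definition cascaded_channel (R : realType) (N M : nat)
    (r : 'cV[R[i]]_N) (F : 'M[R[i]]_(M, N)) (g : 'cV[R[i]]_M) :
    'M[R[i]]_(N, M) :=
  (diagc r)^t* *m F^t* *m diagc g.

(* |(A mu + c)^H b| *)
Definition gain (R : realType) (N M : nat) (A : 'M[R[i]]_(N, M))
    (c : 'cV[R[i]]_N) (mu : 'cV[R[i]]_M) (b : 'cV[R[i]]_N) : R :=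
  normc (((A *m mu + c)^t* *m b) 0 0).

Definition rate (R : realType) (rho sigma2 : R) (N M : nat)
    (A : 'M[R[i]]_(N, M)) (c : 'cV[R[i]]_N)
    (mu : 'cV[R[i]]_M) (b : 'cV[R[i]]_N) : R :=
  log2 (1 + rho / sigma2 * gain A c mu b ^+ 2).

Definition sum_rate (R : realType) (rho sigma2 : R) (K N M : nat)
    (A : 'I_K -> 'M[R[i]]_(N, M)) (c : 'I_K -> 'cV[R[i]]_N)
    (t : 'I_K -> R) (mu : 'I_K -> 'cV[R[i]]_M) (b : 'I_K -> 'cV[R[i]]_N) : R :=
  \sum_(k < K) t k * rate rho sigma2 (A k) (c k) (mu k) (b k).

Record P2_feasible (R : realType) (rho sigma2 : R) (K N M : nat)
    (beta : 'I_K -> R)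
    (A : 'I_K -> 'M[R[i]]_(N, M)) (c : 'I_K -> 'cV[R[i]]_N)
    (t : 'I_K -> R) (mu : 'I_K -> 'cV[R[i]]_M) (b : 'I_K -> 'cV[R[i]]_N) :
    Prop := {
  P2_rate : forall k, beta k <= t k * rate rho sigma2 (A k) (c k) (mu k) (b k);
  P2_mu : forall k, unimodular (mu k);
  P2_b : forall k, unimodular (b k);
  P2_sum : \sum_(k < K) t k = 1;
  P2_ge0 : forall k, 0 <= t k
}.

Definition P2_solution (R : realType) (rho sigma2 : R) (K N M : nat)
    (beta : 'I_K -> R)
    (A : 'I_K -> 'M[R[i]]_(N, M)) (c : 'I_K -> 'cV[R[i]]_N)
    (t : 'I_K -> R) (mu : 'I_K -> 'cV[R[i]]_M) (b : 'I_K -> 'cV[R[i]]_N) :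
    Prop :=
  P2_feasible rho sigma2 beta A c t mu b /\
  forall (t' : 'I_K -> R) (mu' : 'I_K -> 'cV[R[i]]_M) (b' : 'I_K -> 'cV[R[i]]_N),
    P2_feasible rho sigma2 beta A c t' mu' b' ->
    sum_rate rho sigma2 A c t' mu' b' <= sum_rate rho sigma2 A c t mu b.

(* The set of all maximisers, so that [argmax f = [set k]] says that [k] is the
   argmax of [f]. *)
Definition argmax (R : realType) (K : nat) (f : 'I_K -> R) : {set 'I_K} :=
  [set k | [forall j, f j <= f k]].

(* Main.v *)
Require Import Defs.
From mathcomp Require Import all_boot all_order all_algebra.
From mathcomp Require Import complex.
From mathcomp Require Import reals exp.

(** If a user [k] other than the one with the largest gain had
    [t k > beta k / Rhat k], moving the excess time to the user with the largest
    gain, with all phases kept, would preserve feasibility and strictly increase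
    the objective. *)

Import Order.TTheory GRing.Theory Num.Theory.

Local Open Scope ring_scope.
Local Open Scope complex_scope.

Lemma log2_mono (R : realType) : {in Num.pos &, {mono @log2 R : x y / x < y}}.
Proof.
move=> x y x0 y0; rewrite /log2 ltr_pM2r ?ltr_ln //.
by rewrite invr_gt0 ln_gt0 // ltr1n.
Qed.

Lemma snr_gt0 (R : realType) (a x : R) : 0 < a -> 1 + a * x ^+ 2 \in Num.pos.
Proof. by move=> a0; rewrite posrE ltr_wpDr // mulr_ge0 ?sqr_ge0 // ltW. Qed.

Lemma gain_ge0 (R : realType) (N M : nat) (A : 'M[R[i]]_(N, M))
    (c : 'cV[R[i]]_N) (mu : 'cV[R[i]]_M) (b : 'cV[R[i]]_N) :
  0 <= gain A c mu b.
Proof. by rewrite /gain; rewrite /ComplexField.Normc.normc; case: (_ 0 0) => x y; apply: sqrtr_ge0. Qed.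

Lemma rate_lt (R : realType) (rho sigma2 : R) (N M : nat)
    (A A' : 'M[R[i]]_(N, M)) (c c' : 'cV[R[i]]_N)
    (mu mu' : 'cV[R[i]]_M) (b b' : 'cV[R[i]]_N) :
  0 < rho -> 0 < sigma2 -> gain A c mu b < gain A' c' mu' b' ->
  rate rho sigma2 A c mu b < rate rho sigma2 A' c' mu' b'.
Proof.
move=> rho0 s0 lt_gain; have a0 : 0 < rho / sigma2 by rewrite divr_gt0.
rewrite /rate log2_mono ?snr_gt0 // ltrD2l ltr_pM2l //.
by rewrite ltr_pXn2r // nnegrE gain_ge0.
Qed.

Lemma rate_ge0 (R : realType) (rho sigma2 : R) (N M : nat)
    (A : 'M[R[i]]_(N, M)) (c : 'cV[R[i]]_N)
    (mu : 'cV[R[i]]_M) (b : 'cV[R[i]]_N) :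
  0 < rho -> 0 < sigma2 -> 0 <= rate rho sigma2 A c mu b.
Proof.
move=> rho0 s0; rewrite /rate /log2 divr_ge0 ?ln_ge0 ?ler1n //.
by rewrite lerDl mulr_ge0 ?sqr_ge0 // divr_ge0 ?ltW.
Qed.

(** The two corrections are independent summands rather than branches of one case split, so that
    weighted sums split by linearity and [k = l] cancels. *)
Definition transfer {R : realFieldType} {K : nat} (t : 'I_K -> R)
    (k l : 'I_K) (d : R) (j : 'I_K) : R :=
  t j + (if j == l then d else 0) - (if j == k then d else 0).

(** Serves twice: with the rates as [x] it gives the change of the objective, and with [x]
    constantly [1] the conservation of total time. *)
Lemma sum_transfer (R : realFieldType) (K : nat) (t x : 'I_K -> R)
    (k l : 'I_K) (d : R) :
  \sum_j transfer t k l d j * x j = \sum_j t j * x j + d * (x l - x k).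
Proof.
under eq_bigr do rewrite /transfer mulrBl mulrDl.
rewrite sumrB big_split /= mulrBr addrA.
have single m : \sum_(j < K) (if j == m then d else 0) * x j = d * x m.
  rewrite (bigD1 m) //= eqxx big1 ?addr0 // => j /negbTE ->.
  by rewrite mul0r.
by rewrite !single.
Qed.

(* The case [x k = 0] is included: it forces [beta k = 0], and division by zero
   gives [0]. *)
Lemma linear_program_tight (R : realFieldType) (K : nat) (t x beta : 'I_K -> R)
    (k l : 'I_K) :
  0 <= x k -> x k < x l -> 0 <= beta k ->
  (forall j, beta j <= t j * x j) -> (forall j, 0 <= t j) ->
  (forall t', (forall j, beta j <= t' j * x j) -> \sum_j t' j = \sum_j t j ->
     (forall j, 0 <= t' j) -> \sum_j t' j * x j <= \sum_j t j * x j) ->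
  t k = beta k / x k.
Proof.
move=> xk_ge0 lt_x beta0 tP t0 opt.
have s0 : 0 <= beta k / x k by rewrite divr_ge0.
have [le_s sP] : beta k / x k <= t k /\ beta k <= beta k / x k * x k.
  have [xk0|xk_neq0] := eqVneq (x k) 0.
    by move: (tP k); rewrite xk0 invr0 !mulr0.
  by rewrite divfK // ler_pdivrMr // lt_def xk_neq0.
set s := beta k / x k in s0 le_s sP *.
have neq_kl : (k == l) = false by apply: contraTF lt_x => /eqP ->; rewrite ltxx.
(* What remains is that the excess [t k - s] is at most [0]. Multiplied by the positive [x l - x k]
   and added to the objective, this says exactly that transferring the excess to [l] does not beat
   the optimum. *)
apply/eqP; rewrite eq_le le_s andbT -subr_le0.
rewrite -(pmulr_lle0 _ (_ : 0 < x l - x k)) ?subr_gt0 //.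
rewrite -(lerD2l (\sum_j t j * x j)) addr0 -sum_transfer.
have transferk : transfer t k l (t k - s) k = s.
  by rewrite /transfer eqxx neq_kl addr0 subKr.
have transferN j : j != k -> t j <= transfer t k l (t k - s) j.
  move=> /negbTE nk; rewrite /transfer nk subr0 lerDl.
  by case: ifP => //; rewrite subr_ge0.
apply: opt => [j||j].
- have [->|nk] := eqVneq j k; first by rewrite transferk.
  (* Only [x k] and [x l] have a known sign. Any other [j] keeps its time, while at [l] a longer
     time helps because [x l > x k >= 0]. *)
  have [jl|nl] := eqVneq j l; last first.
    by rewrite /transfer (negbTE nk) (negbTE nl) addr0 subr0.
  apply: le_trans (tP j) _; apply: ler_wpM2r (transferN j nk).
  by rewrite jl (le_trans xk_ge0) // ltW.
- have := sum_transfer _ _ t (fun=> 1) k l (t k - s).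
  rewrite subrr mulr0 addr0.
  by under eq_bigr do rewrite mulr1; under [RHS]eq_bigr do rewrite mulr1.
- have [->|nk] := eqVneq j k; first by rewrite transferk.
  exact: le_trans (t0 j) (transferN j nk).
Qed.

Theorem proposition1 (R : realType) (K N M : nat)
    (hK : (1 <= K)%N) (hN : (1 <= N)%N) (hM : (1 <= M)%N)
    (rho sigma2 : R) (hrho : 0 < rho) (hsigma2 : 0 < sigma2)
    (beta : 'I_K -> R)
    (r : 'cV[R[i]]_N) (hr : norm2 r = 1) (F : 'M[R[i]]_(M, N))
    (h : 'I_K -> 'cV[R[i]]_N) (g : 'I_K -> 'cV[R[i]]_M)
    (c : 'I_K -> 'cV[R[i]]_N) (hc : forall k, c k = direct_channel r (h k))
    (A : 'I_K -> 'M[R[i]]_(N, M))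
    (hA : forall k, A k = cascaded_channel r F (g k))
    (t : 'I_K -> R) (mu : 'I_K -> 'cV[R[i]]_M) (b : 'I_K -> 'cV[R[i]]_N)
    (hsol : P2_solution rho sigma2 beta A c t mu b)
    (Rhat : 'I_K -> R)
    (hRhat : forall k, Rhat k = rate rho sigma2 (A k) (c k) (mu k) (b k))
    (kstar : 'I_K)
    (hkstar : argmax (fun k => gain (A k) (c k) (mu k) (b k)) = [set kstar])
    (hbeta : forall k, k != kstar -> 0 <= beta k)
    (k : 'I_K) :
  t k = if k != kstar then beta k / Rhat k
        else 1 - \sum_(j < K | j != kstar) beta j / Rhat j.
Proof.
have [[tP muP bP t1 t0] opt] := hsol.
have gain_lt j : j != kstar ->
    gain (A j) (c j) (mu j) (b j) <
    gain (A kstar) (c kstar) (mu kstar) (b kstar).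
  have /forallP max_kstar : [forall i, gain (A i) (c i) (mu i) (b i) <=
      gain (A kstar) (c kstar) (mu kstar) (b kstar)].
    by have := set11 kstar; rewrite -hkstar inE.
  (* A [j] whose gain reached that of [kstar] would be a maximiser too, hence lie in
     [[set kstar]]. *)
  apply: contraNT; rewrite -leNgt => le_j; rewrite -in_set1 -hkstar inE.
  by apply/forallP => i; apply: le_trans (max_kstar i) le_j.
have tight j : j != kstar -> t j = beta j / Rhat j.
  (* With [mu] and [b] frozen, the problem is linear in the times, with coefficients [Rhat];
     optimality is tested only against changes of [t]. *)
  move=> nj; apply: (@linear_program_tight _ _ t Rhat beta j kstar) => //.
  - by rewrite hRhat rate_ge0.
  - by rewrite !hRhat rate_lt ?gain_lt.
  - exact: hbeta.
  - by move=> i; rewrite hRhat.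
  - move=> t' t'P t'1 t'0.
    under eq_bigr do rewrite hRhat; under [leRHS]eq_bigr do rewrite hRhat.
    apply: opt; split=> //; last by rewrite t'1.
    by move=> i; rewrite -hRhat.
case: ifPn => [/tight //|]; rewrite negbK => /eqP ->.
(* Writing [1] as the total time, the tight shares of the other users cancel and leave [t kstar]. *)
rewrite -t1 (bigD1 kstar) //=.
by under [X in _ - X]eq_bigr => j nj do rewrite -tight //; rewrite addrK.
Qed.
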